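(* Let $A_1,A_2,A_3,A_4$ be four generic points on the real (resp. complex) projective plane. Draw the six lines $\ell_{ij}=(A_iA_j)$, $1\le i<j\le 4$. Pick three generic points $P_{14}\in\ell_{14}$, $P_{24}\in\ell_{24}$, $P_{34}\in\ell_{34}$, and set $$P_{12}=\ell_{12}\cap (P_{14}P_{24}),\quad P_{13}=\ell_{13}\cap (P_{14}P_{34}),\quad P_{23}=\ell_{23}\cap (P_{24}P_{34}).$$ Pick a generic point $B_1$ and define $m_{12}=(B_1P_{12})$, $m_{13}=(B_1P_{13})$, $m_{14}=(B_1P_{14})$. Pick a generic point $B_2\in m_{12}$ and define the lines $m_{23}=(B_2P_{23})$ and $m_{24}=(B_2P_{24})$. Set $B_3=m_{13}\cap m_{23}$ and $B_4=m_{14}\cap m_{24}$. Then the line $m_{34}=(B_3B_4)$ contains $P_{34}$.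
   Context: $(XY)$ denotes the line through two distinct points $X,Y$. ''Generic'' choices are choices belonging to a suitable Zariski dense subset of the appropriate configuration space; concretely, the assertion is that the conclusion holds for all choices in some nonempty Zariski open subset of the space of choices. *)

(* Defs.v *)
From mathcomp Require Import all_boot all_order all_algebra.
From mathcomp Require Import mpoly complex reals.

Set Implicit Arguments.
Unset Strict Implicit.
Unset Printing Implicit Defensive.

Import GRing.Theory.
Local Open Scope ring_scope.

(* The projective plane over K is the set of lines through 0 in K^3; its lines
   are the planes through 0, and incidence is inclusion of subspaces. *)
Section ProjectivePlane.
Variable K : fieldType.

Definition is_point (X : {vspace 'rV[K]_3}) : bool := \dim X == 1%N.
Definition is_line (L : {vspace 'rV[K]_3}) : bool := \dim L == 2%N.

Record point := Point {
  point_vspace :> {vspace 'rV[K]_3};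
  point_vspaceP : is_point point_vspace }.

(* The span of X and Y is the line (XY) only under line_defined X Y, and the
   intersection of L and M is a point only under meet_defined L M. *)
Definition line (X Y : {vspace 'rV[K]_3}) : {vspace 'rV[K]_3} := (X + Y)%VS.
Definition meet (L M : {vspace 'rV[K]_3}) : {vspace 'rV[K]_3} := (L :&: M)%VS.

Definition line_defined (X Y : {vspace 'rV[K]_3}) : bool :=
  [&& is_point X, is_point Y & X != Y].
Definition meet_defined (L M : {vspace 'rV[K]_3}) : bool :=
  [&& is_line L, is_line M & L != M].

End ProjectivePlane.

(* Zariski topology on the n-fold product of the projective plane. Row i of a
   matrix of size n x 3 holds homogeneous coordinates of the i-th point; the
   variable of index mxvec_index i j stands for its entry (i, j). *)
Section Zariski.
Variables (K : fieldType) (n : nat).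

Definition multihomogeneous (f : {mpoly K[n * 3]}) : Prop :=
  exists d : 'I_n -> nat,
    forall m, m \in msupp f ->
      forall i : 'I_n, (\sum_(j < 3) m (mxvec_index i j))%N = d i.

Definition hcoords (p : 'I_n -> point K) (x : 'M[K]_(n, 3)) : Prop :=
  forall i, row i x != 0 /\ (p i : {vspace 'rV[K]_3}) = <[row i x]>%VS.

Definition vanishes_at (f : {mpoly K[n * 3]}) (p : 'I_n -> point K) : Prop :=
  forall x, hcoords p x -> f.@[fun k => mxvec x 0 k] = 0.

Definition zariski_closed (Z : ('I_n -> point K) -> Prop) : Prop :=
  exists F : {mpoly K[n * 3]} -> Prop,
    (forall f, F f -> multihomogeneous f) /\
    (forall p, Z p <-> (forall f, F f -> vanishes_at f p)).

Definition zariski_open (U : ('I_n -> point K) -> Prop) : Prop :=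
  zariski_closed (fun p => ~ U p).

End Zariski.

Section Construction.
Variable K : fieldType.

Record choices := Choices {
  A1 : point K; A2 : point K; A3 : point K; A4 : point K;
  P14 : point K; P24 : point K; P34 : point K;
  B1 : point K; B2 : point K }.

Definition chosen_points (c : choices) : 'I_9 -> point K :=
  tnth [tuple A1 c; A2 c; A3 c; A4 c; P14 c; P24 c; P34 c; B1 c; B2 c].

Variable c : choices.

Definition l12 := line (A1 c) (A2 c).
Definition l13 := line (A1 c) (A3 c).
Definition l14 := line (A1 c) (A4 c).
Definition l23 := line (A2 c) (A3 c).
Definition l24 := line (A2 c) (A4 c).
Definition l34 := line (A3 c) (A4 c).

Definition P12 := meet l12 (line (P14 c) (P24 c)).
Definition P13 := meet l13 (line (P14 c) (P34 c)).
Definition P23 := meet l23 (line (P24 c) (P34 c)).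

Definition m12 := line (B1 c) P12.
Definition m13 := line (B1 c) P13.
Definition m14 := line (B1 c) (P14 c).
Definition m23 := line (B2 c) P23.
Definition m24 := line (B2 c) (P24 c).

Definition B3 := meet m13 m23.
Definition B4 := meet m14 m24.

Definition m34 := line B3 B4.

(* The space of choices: the incidences imposed on the chosen points, together
   with exactly the nondegeneracy conditions needed for the six lines (AiAj)
   and for the line m12, on which B2 is chosen, to exist. *)
Definition choice_space : Prop :=
  [/\ [&& line_defined (A1 c) (A2 c), line_defined (A1 c) (A3 c),
          line_defined (A1 c) (A4 c), line_defined (A2 c) (A3 c),
          line_defined (A2 c) (A4 c) & line_defined (A3 c) (A4 c)],
      [&& (P14 c <= l14)%VS, (P24 c <= l24)%VS & (P34 c <= l34)%VS],
      [&& line_defined (P14 c) (P24 c),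
          meet_defined l12 (line (P14 c) (P24 c)) & line_defined (B1 c) P12] &
      (B2 c <= m12)%VS].

Definition construction_defined : Prop :=
  [/\ [&& line_defined (P14 c) (P24 c), line_defined (P14 c) (P34 c)
        & line_defined (P24 c) (P34 c)],
      [&& meet_defined l12 (line (P14 c) (P24 c)),
          meet_defined l13 (line (P14 c) (P34 c))
        & meet_defined l23 (line (P24 c) (P34 c))],
      [&& line_defined (B1 c) P12, line_defined (B1 c) P13,
          line_defined (B1 c) (P14 c), line_defined (B2 c) P23
        & line_defined (B2 c) (P24 c)],
      meet_defined m13 m23 && meet_defined m14 m24 &
      line_defined B3 B4].

End Construction.

(* Q holds for generic choices. The space of choices is open in a tower of
   projective bundles, hence irreducible, so that a nonempty relatively open
   subset of it is automatically dense. *)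
Definition for_generic_choices (K : fieldType) (Q : choices K -> Prop) : Prop :=
  exists U : ('I_9 -> point K) -> Prop,
    [/\ zariski_open U,
        exists c, choice_space c /\ U (chosen_points c) &
        forall c, choice_space c -> U (chosen_points c) -> Q c].

(* Main.v *)
Require Import Defs.
From mathcomp Require Import all_boot all_order all_algebra.
From mathcomp Require Import mpoly complex reals ring.

(** Why the configuration closes up.  Generically [P14], [P24], [P34] avoid the
vertices [Ai], so representatives [ai] of the points [Ai] can be rescaled until
[Pi4] is the class of [ai - a4] for [i = 1, 2, 3] ([side_lift]).  The vector
[ai - aj] lies both in the plane of [ai], [aj] and in the plane of [ai - a4],
[aj - a4], so [Pij] is the class of [ai - aj] for every pair [i, j]
([meet_side]).  A point of [m12] other than [P12] is then the class of
[b1 - t (a1 - a2)] for some scalar [t].  With [bi := b1 - t (a1 - ai)] one has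
[bi - bj = t (ai - aj)] for all [i, j]; hence [bi] lies on each of the two lines
that define [Bi], it represents [Bi], and [b3 - b4 = t (a3 - a4)] shows that the
line [(B3 B4)] contains [P34] ([normalised_configuration]).

The points for which all this makes sense have to be cut out by one
multihomogeneous polynomial in the coordinates of the nine chosen points.  It is
a product of 3 x 3 determinants ([genericity]).  Only one of the required
conditions, [m13 <> m23], involves derived points in an essential way: it says
that [B1] is off the line through [P12], [P13], [P23].  Coordinates of [P13] and
[P23] that are polynomial in those of the chosen points come from the
Grassmann-Cayley formula for the meet of two lines ([crossing]).  Being
multihomogeneous, the polynomial vanishes for one system of homogeneous
coordinates if and only if it vanishes for all ([genericP]); so it may be
evaluated on the rescaled coordinates, where its factors become the
determinants that the geometric argument uses.

The open set is nonempty because the degenerate solution [Bi = Ai] belongs to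
it when the [Ai] form the standard frame; the polynomial takes the value 1
there.  The whole argument is valid over every field. *)

Set Implicit Arguments.
Unset Strict Implicit.
Unset Printing Implicit Defensive.

Import GRing.Theory.
Local Open Scope ring_scope.

(** * Multihomogeneous polynomials and their nonvanishing loci *)

Section MultiDegree.
Variables (K : fieldType) (n : nat).
Implicit Types (d e : 'I_n -> nat) (f g : {mpoly K[n * 3]}).

(** [multihomogeneous] with its degree as a parameter: closure under sums needs
the two degrees to be the same. *)
Definition multidegree d f : Prop :=
  forall m, m \in msupp f ->
    forall i : 'I_n, (\sum_(j < 3) m (mxvec_index i j))%N = d i.

Definition row_degree (i : 'I_n) : 'I_n -> nat := fun k => nat_of_bool (k == i).

Lemma multidegree_eq d e f : d =1 e -> multidegree d f -> multidegree e f.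
Proof. by move=> de fd m /fd {}fd i; rewrite fd. Qed.

Lemma multidegreeX i j : multidegree (row_degree i) 'X_(mxvec_index i j).
Proof.
move=> m; rewrite msuppX inE => /eqP -> k; rewrite /row_degree.
under eq_bigr => l _.
  rewrite mnm1E (inj_eq (@cast_ord_inj _ _ _)) (inj_eq enum_rank_inj) xpair_eqE.
  over.
rewrite (eq_sym k); case: (i == k) => /=; last by rewrite big1.
by rewrite (bigD1 j) //= eqxx big1 // => l; rewrite eq_sym => /negPf ->.
Qed.

Lemma multidegreeM d e f g :
  multidegree d f -> multidegree e g ->
  multidegree (fun i => d i + e i)%N (f * g).
Proof.
move=> fd ge m /msuppM_le /allpairsP [[m1 m2] /= [m1f m2g ->]] i.
by under eq_bigr do rewrite mnmDE; rewrite big_split /= fd ?ge.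
Qed.

Lemma multidegreeB d f g :
  multidegree d f -> multidegree d g -> multidegree d (f - g).
Proof.
by move=> fd gd m /msuppB_le; rewrite mem_cat => /orP[/fd|/gd].
Qed.

Lemma multidegreeD d f g :
  multidegree d f -> multidegree d g -> multidegree d (f + g).
Proof.
by move=> fd gd m /msuppD_le; rewrite mem_cat => /orP[/fd|/gd].
Qed.

(** Each monomial picks up the factor [s i] once for every variable of row [i],
that is [d i] times. *)
Lemma meval_scale_rows d f (s : 'I_n -> K) (x y : 'M[K]_(n, 3)) :
  multidegree d f -> (forall i, row i y = s i *: row i x) ->
  f.@[fun k => mxvec y 0 k] = (\prod_i s i ^+ d i) * f.@[fun k => mxvec x 0 k].
Proof.
move=> fd yx; rewrite !mevalE mulr_sumr; apply: eq_big_seq => m /fd md.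
rewrite mulrCA; congr (_ * _).
have prod_entries (F : 'I_(n * 3) -> K) :
    \prod_k F k = \prod_i \prod_j F (mxvec_index i j).
  rewrite (reindex _ (curry_mxvec_bij n 3)) pair_bigA.
  by apply: eq_bigr => -[].
rewrite !prod_entries -big_split /=.
apply: eq_bigr => i _; rewrite -md -prodrXr -big_split /=.
apply: eq_bigr => j _; rewrite !mxvecE.
have /rowP/(_ j) := yx i.
by rewrite !mxE => ->; rewrite exprMn.
Qed.

Lemma meval_neq0_hcoords d f (p : 'I_n -> point K) (x y : 'M[K]_(n, 3)) :
  multidegree d f -> hcoords p x -> hcoords p y ->
  f.@[fun k => mxvec x 0 k] != 0 -> f.@[fun k => mxvec y 0 k] != 0.
Proof.
move=> fd px py fx.
have /fin_all_exists [s ys] : forall i, exists c, row i y = c *: row i x.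
  move=> i; have [_ pxi] := px i; have [_ pyi] := py i.
  by apply/vlineP; rewrite -pxi pyi memv_line.
rewrite (meval_scale_rows fd ys) mulf_neq0 // prodf_seq_neq0.
apply/allP => i _ /=; rewrite expf_neq0 //.
by have [+ _] := py i; rewrite ys; apply: contraNneq => ->; rewrite scale0r.
Qed.

(** Equality in a field is decidable, so that vanishing is stable under double
negation; this matches the two complements in [zariski_open]. *)
Lemma zariski_open_nonvanishing d f :
  multidegree d f -> zariski_open (fun p : 'I_n -> point K => ~ vanishes_at f p).
Proof.
move=> fd; exists (fun g => g = f); split => [g ->|p]; first by exists d.
split => [nnfp g -> x px|fp nfp]; last exact: nfp (fp f erefl).
by apply/eqP/negPn/negP => /eqP fx; apply: nnfp => fp; apply/fx/fp.
Qed.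

End MultiDegree.

(** * Brackets and the genericity polynomial *)

Local Notation ord9 k := (@Ordinal 9 k isT).

Section Bracket.
Variable R : comNzRingType.
Implicit Types u v w p q : 'rV[R]_3.

(** The determinant with rows [u], [v], [w], expanded so that [ring] decides
identities between brackets. *)
Definition bracket u v w : R :=
  u 0 0 * (v 0 1 * w 0 2 - v 0 2 * w 0 1)
  - u 0 1 * (v 0 0 * w 0 2 - v 0 2 * w 0 0)
  + u 0 2 * (v 0 0 * w 0 1 - v 0 1 * w 0 0).

(** Grassmann-Cayley formula for the intersection of the lines [(uv)] and [(pq)]:
the combination of [p] and [q] whose bracket with [u], [v] is zero. *)
Definition crossing u v p q : 'rV[R]_3 :=
  bracket u v q *: p - bracket u v p *: q.

(** In the first three lines the two factors keep [Pi4] away from [A4] and from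
[Ai], and also make [A4] and two other vertices independent.  The next four
factors put [B1] off the line [(P14 P34)], [B2] off the lines [(P24 P34)] and
[(P14 P24)], and separate [B2] from [B1].  The last one puts [B1] off the line
through [P13] and [P23]. *)
Definition genericity (a1 a2 a3 a4 p14 p24 p34 b1 b2 : 'rV[R]_3) : R :=
  (bracket a1 a2 p14 * bracket a2 a4 p14)
  * (bracket a2 a1 p24 * bracket a1 a4 p24)
  * (bracket a3 a1 p34 * bracket a1 a4 p34)
  * (bracket b1 p14 p34 * bracket b2 p24 p34)
  * (bracket b2 p14 p24 * bracket b1 b2 p14)
  * bracket b1 (crossing a1 a3 p14 p34) (crossing a2 a3 p24 p34).

Definition row_genericity (x : 'M[R]_(9, 3)) : R :=
  genericity (row (ord9 0) x) (row (ord9 1) x) (row (ord9 2) x) (row (ord9 3) x)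
    (row (ord9 4) x) (row (ord9 5) x) (row (ord9 6) x) (row (ord9 7) x)
    (row (ord9 8) x).

End Bracket.

Section BracketMorphism.
Variables (R S : comNzRingType) (phi : {rmorphism R -> S}).

Lemma bracket_map (u v w : 'rV[R]_3) :
  phi (bracket u v w) = bracket (map_mx phi u) (map_mx phi v) (map_mx phi w).
Proof. by rewrite /bracket !mxE !(rmorphD, rmorphN, rmorphM). Qed.

Lemma crossing_map (u v p q : 'rV[R]_3) :
  map_mx phi (crossing u v p q) =
  crossing (map_mx phi u) (map_mx phi v) (map_mx phi p) (map_mx phi q).
Proof. by rewrite /crossing map_mxB !map_mxZ !bracket_map. Qed.

Lemma row_genericity_map (x : 'M[R]_(9, 3)) :
  phi (row_genericity x) = row_genericity (map_mx phi x).
Proof.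
by rewrite /row_genericity /genericity -!map_row !rmorphM !bracket_map !crossing_map.
Qed.

End BracketMorphism.

(** * Multidegree of the genericity polynomial *)

Section GenericityPolynomial.
Variable K : fieldType.

Definition generic_mx : 'M[{mpoly K[9 * 3]}]_(9, 3) :=
  \matrix_(i, j) 'X_(mxvec_index i j).

Definition genericity_poly : {mpoly K[9 * 3]} := row_genericity generic_mx.

Lemma meval_genericity_poly (x : 'M[K]_(9, 3)) :
  genericity_poly.@[fun k => mxvec x 0 k] = row_genericity x.
Proof.
rewrite /genericity_poly row_genericity_map; congr row_genericity.
by apply/matrixP => i j; rewrite !mxE /= mevalXU mxvecE.
Qed.

Definition vec_multidegree d (u : 'rV[{mpoly K[9 * 3]}]_3) : Prop :=
  forall j, multidegree d (u 0 j).

Lemma vec_multidegree_generic i :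
  vec_multidegree (row_degree i) (row i generic_mx).
Proof. by move=> j; rewrite !mxE; apply: multidegreeX. Qed.

Lemma multidegree_bracket d1 d2 d3 u v w :
  vec_multidegree d1 u -> vec_multidegree d2 v -> vec_multidegree d3 w ->
  multidegree (fun i => d1 i + (d2 i + d3 i))%N (bracket u v w).
Proof.
move=> ud vd wd.
have minor j k : multidegree (fun i => d2 i + d3 i)%N
    (v 0 j * w 0 k - v 0 k * w 0 j).
  by apply: multidegreeB; apply: multidegreeM.
apply: multidegreeD; last exact: multidegreeM.
by apply: multidegreeB; apply: multidegreeM.
Qed.

Lemma vec_multidegree_crossing d1 d2 d3 d4 u v p q :
  vec_multidegree d1 u -> vec_multidegree d2 v ->
  vec_multidegree d3 p -> vec_multidegree d4 q ->
  vec_multidegree (fun i => d1 i + d2 i + d3 i + d4 i)%N (crossing u v p q).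
Proof.
move=> ud vd pd qd j; rewrite /crossing !mxE.
apply: multidegreeB.
  apply: multidegree_eq (multidegreeM (multidegree_bracket ud vd qd) (pd j)).
  by move=> i /=; ring.
apply: multidegree_eq (multidegreeM (multidegree_bracket ud vd pd) (qd j)).
by move=> i /=; ring.
Qed.

Lemma multidegree_genericity_poly : exists d, multidegree d genericity_poly.
Proof.
have deg := vec_multidegree_generic.
eexists; rewrite /genericity_poly /row_genericity /genericity.
repeat apply: multidegreeM; apply: multidegree_bracket; try exact: deg;
  exact: vec_multidegree_crossing.
Qed.

End GenericityPolynomial.

(** * Incidences in terms of brackets *)

Section Incidence.
Variable K : fieldType.
Implicit Types (u v w p q : 'rV[K]_3) (L M : {vspace 'rV[K]_3}).

Lemma mem_line2 u v a b : a *: u + b *: v \in (<[u]> + <[v]>)%VS.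
Proof. by rewrite memv_add // memvZ // memv_line. Qed.

Lemma bracket_notin u v w :
  bracket u v w != 0 -> w \notin (<[u]> + <[v]>)%VS.
Proof.
apply: contraNN => /memv_addP [_ /vlineP[a ->] [_ /vlineP[b ->] ->]].
by apply/eqP; rewrite /bracket !mxE; ring.
Qed.

Lemma bracketC23 u v w : bracket u v w = - bracket u w v.
Proof. by rewrite /bracket; ring. Qed.

Lemma bracketC12 u v w : bracket u v w = - bracket v u w.
Proof. by rewrite /bracket; ring. Qed.

Lemma bracket_neq0 u v w : bracket u v w != 0 -> u != 0.
Proof. by apply: contraNneq => ->; apply/eqP; rewrite /bracket !mxE; ring. Qed.

Lemma is_point_vline u : u != 0 -> is_point <[u]>%VS.
Proof. by rewrite /is_point dim_vline => ->. Qed.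

Lemma bracket_line_defined u v w :
  bracket u v w != 0 -> line_defined <[u]>%VS <[v]>%VS.
Proof.
move=> uvw; have vuw : bracket v u w != 0 by rewrite bracketC12 oppr_eq0.
rewrite /line_defined !is_point_vline ?(bracket_neq0 uvw) ?(bracket_neq0 vuw) //=.
have: v \notin (<[u]> + <[w]>)%VS.
  by apply: bracket_notin; rewrite bracketC23 oppr_eq0.
apply: contraNneq => uv; apply: (subvP (addvSl _ _)).
by rewrite uv memv_line.
Qed.

Lemma bracket_triangle u v w : bracket u v w != 0 ->
  [/\ line_defined <[u]>%VS <[v]>%VS, line_defined <[u]>%VS <[w]>%VS
    & line_defined <[v]>%VS <[w]>%VS].
Proof.
move=> uvw; split; first exact: bracket_line_defined uvw.
  by apply: (@bracket_line_defined _ _ v); rewrite bracketC23 oppr_eq0.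
apply: (@bracket_line_defined _ _ u).
by rewrite bracketC23 bracketC12 opprK.
Qed.

Lemma dim_capv_lt L M : \dim L = \dim M -> L != M -> (\dim (L :&: M) < \dim L)%N.
Proof.
move=> dLM; rewrite ltn_neqAle dimvS ?capvSl // andbT; apply: contraNN => /eqP dI.
have /eqP LIL : (L :&: M == L)%VS by rewrite eqEdim capvSl dI leqnn.
by rewrite eqEdim -{1}LIL capvSr dLM leqnn.
Qed.

Lemma is_line_line L M : line_defined L M -> is_line (line L M).
Proof.
rewrite /is_point /is_line /line => /and3P [/eqP dL /eqP dM LM].
apply/eqP; rewrite dimv_disjoint_sum ?dL ?dM //.
apply/eqP; rewrite -dimv_eq0 -leqn0.
by have := @dim_capv_lt L M; rewrite dL dM ltnS => ->.
Qed.

Lemma bracket_meet_defined u v (M : {vspace 'rV[K]_3}) w :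
  bracket u v w != 0 -> w \in M -> is_line M ->
  meet_defined (line <[u]>%VS <[v]>%VS) M.
Proof.
move=> uvw wM lM; rewrite /meet_defined lM (is_line_line (bracket_line_defined uvw)).
by apply: contraNneq (bracket_notin uvw) => uvM; rewrite -/(line _ _) uvM.
Qed.

Lemma meet_vline L M w :
  meet_defined L M -> w != 0 -> w \in L -> w \in M -> meet L M = <[w]>%VS.
Proof.
rewrite /is_line => /and3P [/eqP dL /eqP dM LM] w0 wL wM; apply/esym/eqP.
have wLM : (<[w]> <= L :&: M)%VS by rewrite subv_cap -!memvE wL wM.
rewrite eqEdim wLM dim_vline w0.
by have := @dim_capv_lt L M; rewrite dL dM ltnS => ->.
Qed.

(** [u - v = (u - w) - (v - w)] belongs to both lines.  This turns [P12], [P13]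
and [P23] into differences of lifts of the vertices. *)
Lemma meet_side u v w : bracket u v w != 0 ->
  [/\ line_defined <[u - w]>%VS <[v - w]>%VS,
      meet_defined (line <[u]>%VS <[v]>%VS) (line <[u - w]>%VS <[v - w]>%VS)
    & meet (line <[u]>%VS <[v]>%VS) (line <[u - w]>%VS <[v - w]>%VS)
      = <[u - v]>%VS].
Proof.
move=> uvw.
have ld : line_defined <[u - w]>%VS <[v - w]>%VS.
  apply: (@bracket_line_defined _ _ w).
  suff -> : bracket (u - w) (v - w) w = bracket u v w by [].
  by rewrite /bracket !mxE; ring.
have md : meet_defined (line <[u]>%VS <[v]>%VS) (line <[u - w]>%VS <[v - w]>%VS).
  apply: (@bracket_meet_defined _ _ _ (u - w)) (is_line_line ld).
    suff -> : bracket u v (u - w) = - bracket u v w by rewrite oppr_eq0.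
    by rewrite /bracket !mxE; ring.
  by rewrite (subvP (addvSl _ _)) ?memv_line.
split=> //; apply: meet_vline md _ _ _.
- apply: contraNneq uvw => /eqP; rewrite subr_eq0 => /eqP ->.
  by apply/eqP; rewrite /bracket; ring.
- by have := mem_line2 u v 1 (-1); rewrite scale1r scaleN1r.
have -> : u - v = 1 *: (u - w) + -1 *: (v - w).
  by apply/rowP => j; rewrite !mxE; ring.
exact: mem_line2.
Qed.

Lemma vline_scale a u : a != 0 -> <[a *: u]>%VS = <[u]>%VS :> {vspace 'rV[K]_3}.
Proof.
move=> a0; apply/eqP; rewrite eqEsubv -!memvE memvZ ?memv_line //=.
by apply/vlineP; exists a^-1; rewrite scalerA mulVf // scale1r.
Qed.

End Incidence.

(** * The configuration in normalised coordinates *)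

Section Configuration.
Variable K : fieldType.

(** All incidences follow from [bi - bj = t (ai - aj)], where
[bi := b1 - t (a1 - ai)]; the factors of [genericity] only serve to make the
lines and intersection points exist. *)
Lemma normalised_configuration (c : choices K) (a1 a2 a3 a4 b1 : 'rV[K]_3) (t : K) :
  [/\ A1 c = <[a1]>%VS :> {vspace _}, A2 c = <[a2]>%VS :> {vspace _},
      A3 c = <[a3]>%VS :> {vspace _} & A4 c = <[a4]>%VS :> {vspace _}] ->
  [/\ P14 c = <[a1 - a4]>%VS :> {vspace _}, P24 c = <[a2 - a4]>%VS :> {vspace _}
    & P34 c = <[a3 - a4]>%VS :> {vspace _}] ->
  B1 c = <[b1]>%VS :> {vspace _} ->
  B2 c = <[b1 - t *: (a1 - a2)]>%VS :> {vspace _} ->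
  genericity a1 a2 a3 a4 (a1 - a4) (a2 - a4) (a3 - a4) b1 (b1 - t *: (a1 - a2)) != 0 ->
  [/\ choice_space c, construction_defined c & (P34 c <= m34 c)%VS].
Proof.
move=> [A1E A2E A3E A4E] [P14E P24E P34E] B1E B2E; set b2 := b1 - _ in B2E *.
set p14 := a1 - a4; set p24 := a2 - a4; set p34 := a3 - a4.
have E124 : bracket a1 a2 p14 = - bracket a1 a2 a4.
  by rewrite /bracket !mxE; ring.
have E134 : bracket a3 a1 p34 = bracket a1 a3 a4.
  by rewrite /bracket !mxE; ring.
have E12 : bracket b1 b2 p14 = t * bracket b1 p24 p14.
  by rewrite /b2 /p14 /p24 /bracket !mxE; ring.
(* In these coordinates the two crossings are, up to sign,
   [bracket a1 a3 a4] times [a1 - a3] and [bracket a2 a3 a4] times [a2 - a3]. *)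
have ED : bracket b1 (crossing a1 a3 p14 p34) (crossing a2 a3 p24 p34)
   = (bracket a1 a3 a4 * bracket a2 a3 a4) * bracket b1 (a1 - a3) (a2 - a3).
  by rewrite /p14 /p24 /p34 /crossing /bracket !mxE; ring.
rewrite /genericity E124 E134 E12 ED !(mulf_eq0, oppr_eq0) !negb_or -!andbA.
case/and5P=> d124 _ _ _; case/and5P=> d134 _ d_b1p14p34 d_b2p24p34.
case/and5P=> d_b2p14p24 t0 d_b1p24p14 _; case/andP=> d234 d_axis.
have [ld1424 md12 P12E'] := meet_side d124.
have [ld1434 md13 P13E'] := meet_side d134.
have [ld2434 md23 P23E'] := meet_side d234.
have P12E : P12 c = <[a1 - a2]>%VS by rewrite /P12 /l12 A1E A2E P14E P24E.
have P13E : P13 c = <[a1 - a3]>%VS by rewrite /P13 /l13 A1E A3E P14E P34E.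
have P23E : P23 c = <[a2 - a3]>%VS by rewrite /P23 /l23 A2E A3E P24E P34E.
pose b3 := b1 - t *: (a1 - a3); pose b4 := b1 - t *: (a1 - a4).
have ld_b1p12 : line_defined <[b1]>%VS <[a1 - a2]>%VS.
  apply: (@bracket_line_defined _ _ _ p14).
  suff -> : bracket b1 (a1 - a2) p14 = - bracket b1 p24 p14 by rewrite oppr_eq0.
  by rewrite /p14 /p24 /bracket !mxE; ring.
have d_b1p13p14 : bracket b1 (a1 - a3) p14 != 0.
  suff -> : bracket b1 (a1 - a3) p14 = bracket b1 p14 p34 by [].
  by rewrite /p14 /p34 /bracket !mxE; ring.
have ld_b1p13 := bracket_line_defined d_b1p13p14.
have ld_b1p14 := bracket_line_defined d_b1p14p34.
have ld_b2p23 : line_defined <[b2]>%VS <[a2 - a3]>%VS.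
  apply: (@bracket_line_defined _ _ _ p34).
  suff -> : bracket b2 (a2 - a3) p34 = bracket b2 p24 p34 by [].
  by rewrite /p24 /p34 /bracket !mxE; ring.
have ld_b2p24 := bracket_line_defined d_b2p24p34.
have m13E : m13 c = line <[b1]>%VS <[a1 - a3]>%VS by rewrite /m13 B1E P13E.
have m14E : m14 c = line <[b1]>%VS <[p14]>%VS by rewrite /m14 B1E P14E.
have m23E : m23 c = line <[b2]>%VS <[a2 - a3]>%VS by rewrite /m23 B2E P23E.
have m24E : m24 c = line <[b2]>%VS <[p24]>%VS by rewrite /m24 B2E P24E.
have md3 : meet_defined (m13 c) (m23 c).
  rewrite m13E m23E; apply: bracket_meet_defined d_axis _ (is_line_line ld_b2p23).
  by rewrite (subvP (addvSr _ _)) ?memv_line.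
have md4 : meet_defined (m14 c) (m24 c).
  rewrite m14E m24E; apply: (@bracket_meet_defined _ _ _ _ p24).
  - by rewrite bracketC23 oppr_eq0.
  - by rewrite (subvP (addvSr _ _)) ?memv_line.
  - exact: is_line_line.
(* [b3 - b4 = t p34] and [b3 = b1 - t (p14 - p34)], so [B3 = B4] would put
   [B1] on the line [(P14 P34)]. *)
have d_b3b4 : bracket b3 b4 p14 != 0.
  suff -> : bracket b3 b4 p14 = t * bracket b1 p14 p34.
    by rewrite mulf_neq0.
  by rewrite /b3 /b4 /p14 /p34 /bracket !mxE; ring.
have on_line (u v w : 'rV[K]_3) (r : K) : w = u - r *: v -> w \in line <[u]>%VS <[v]>%VS.
  by move=> ->; rewrite -scaleNr -[X in X + _]scale1r mem_line2.
have B3E : B3 c = <[b3]>%VS.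
  apply: meet_vline md3 (bracket_neq0 d_b3b4) _ _.
    by rewrite m13E; apply: (on_line _ _ _ t).
  rewrite m23E; apply: (on_line _ _ _ t).
  by apply/rowP => j; rewrite !mxE; ring.
have B4E : B4 c = <[b4]>%VS.
  have d_b4b3 : bracket b4 b3 p14 != 0 by rewrite bracketC12 oppr_eq0.
  apply: meet_vline md4 (bracket_neq0 d_b4b3) _ _.
    by rewrite m14E; apply: (on_line _ _ _ t).
  rewrite m24E; apply: (on_line _ _ _ t).
  by apply/rowP => j; rewrite !mxE; ring.
have [ld12 ld14 ld24] := bracket_triangle d124.
have [ld13 _ ld34] := bracket_triangle d134.
have [ld23 _ _] := bracket_triangle d234.
split.
- split; rewrite ?A1E ?A2E ?A3E ?A4E ?P14E ?P24E ?P34E ?B1E ?B2E ?P12E.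
  + by rewrite ld12 ld13 ld14 ld23 ld24 ld34.
  + rewrite /l14 /l24 /l34 A1E A2E A3E A4E -!memvE.
    by rewrite !(on_line _ _ _ 1) ?scale1r.
  + by rewrite ld1424 /l12 A1E A2E md12 ld_b1p12.
  + by rewrite /m12 B1E P12E -memvE (on_line _ _ _ t).
- split; rewrite ?P14E ?P24E ?P34E ?B1E ?B2E ?P12E ?P13E ?P23E ?B3E ?B4E.
  + by rewrite ld1424 ld1434 ld2434.
  + by rewrite /l12 /l13 /l23 A1E A2E A3E md12 md13 md23.
  + by rewrite ld_b1p12 ld_b1p13 ld_b1p14 ld_b2p23 ld_b2p24.
  + by rewrite md3 md4.
  + exact: bracket_line_defined d_b3b4.
rewrite P34E /m34 B3E B4E -memvE.
have -> : a3 - a4 = t^-1 *: b3 + - t^-1 *: b4.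
  by apply/rowP => j; rewrite !mxE; field.
exact: mem_line2.
Qed.

End Configuration.

(** * From generic choices to normalised coordinates *)

Section Genericity.
Variable K : fieldType.
Implicit Types (c : choices K).

Definition generic c : Prop := ~ vanishes_at (genericity_poly K) (chosen_points c).

Definition coordinates c (a1 a2 a3 a4 p14 p24 p34 b1 b2 : 'rV[K]_3) : Prop :=
  [/\ [/\ A1 c = <[a1]>%VS :> {vspace _}, A2 c = <[a2]>%VS :> {vspace _},
         A3 c = <[a3]>%VS :> {vspace _} & A4 c = <[a4]>%VS :> {vspace _}],
      [/\ P14 c = <[p14]>%VS :> {vspace _}, P24 c = <[p24]>%VS :> {vspace _}
        & P34 c = <[p34]>%VS :> {vspace _}],
      B1 c = <[b1]>%VS :> {vspace _} & B2 c = <[b2]>%VS :> {vspace _}].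

Lemma point_coordinates (X : point K) : exists u, X = <[u]>%VS :> {vspace _}.
Proof.
have /eqP dX := point_vspaceP X.
have nzX : vpick X != 0 by rewrite vpick0 -dimv_eq0 dX.
exists (vpick X); apply/esym/eqP.
by rewrite eqEdim -memvE memv_pick dX dim_vline nzX.
Qed.

Lemma point_vline_neq0 (X : point K) u : X = <[u]>%VS :> {vspace _} -> u != 0.
Proof. by case: X => Y /= + YE; rewrite /is_point YE dim_vline; case: (u != 0). Qed.

(** Vanishing of a multihomogeneous polynomial can be tested on any single
system of homogeneous coordinates. *)
Lemma genericP c a1 a2 a3 a4 p14 p24 p34 b1 b2 :
  coordinates c a1 a2 a3 a4 p14 p24 p34 b1 b2 ->
  generic c <-> genericity a1 a2 a3 a4 p14 p24 p34 b1 b2 != 0.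
Proof.
move=> [[A1E A2E A3E A4E] [P14E P24E P34E] B1E B2E].
pose y := \matrix_i tnth [tuple a1; a2; a3; a4; p14; p24; p34; b1; b2] i.
have <- : (genericity_poly K).@[fun k => mxvec y 0 k]
    = genericity a1 a2 a3 a4 p14 p24 p34 b1 b2.
  by rewrite meval_genericity_poly /row_genericity !rowK.
have cy : hcoords (chosen_points c) y.
  move=> i; rewrite rowK.
  suff e : chosen_points c i =
      <[tnth [tuple a1; a2; a3; a4; p14; p24; p34; b1; b2] i]>%VS :> {vspace _}.
    by rewrite (point_vline_neq0 e).
  rewrite /chosen_points (tnth_nth (A1 c)) (tnth_nth 0) /=.
  by case: i => -[|[|[|[|[|[|[|[|[|]]]]]]]]].
split => [gc|yn0 vc]; last first.
  by rewrite (vc y cy) eqxx in yn0.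
have [d fd] := multidegree_genericity_poly K.
apply/eqP => fy; apply: gc => x cx; apply/eqP/negPn/negP => fx.
by have := meval_neq0_hcoords fd cx cy fx; rewrite fy eqxx.
Qed.

(** Rescaling [a] moves a point [p] of the line [(ao)], distinct from both [a] and
[o], to the class of the difference of [a] and [o].  The vector [o] is kept
fixed, so that this can be done on three lines through [o] at once. *)
Lemma side_lift (a o p u v : 'rV[K]_3) :
  p \in line <[a]>%VS <[o]>%VS -> bracket a u p != 0 -> bracket v o p != 0 ->
  exists2 a', <[a]>%VS = <[a']>%VS :> {vspace 'rV[K]_3}
            & <[p]>%VS = <[a' - o]>%VS :> {vspace 'rV[K]_3}.
Proof.
case/memv_addP=> _ /vlineP[r ->] [_ /vlineP[s ->] ->].
have -> : bracket a u (r *: a + s *: o) = s * bracket a u o.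
  by rewrite /bracket !mxE; ring.
have -> : bracket v o (r *: a + s *: o) = r * bracket v o a.
  by rewrite /bracket !mxE; ring.
rewrite !mulf_eq0 !negb_or => /andP[s0 _] /andP[r0 _].
exists (- (r / s) *: a); first by rewrite vline_scale // oppr_eq0 mulf_neq0 ?invr_eq0.
rewrite -(@vline_scale _ (- s) (_ - o)) ?oppr_eq0 //; congr <[_]>%VS.
by apply/rowP => j; rewrite !mxE; field.
Qed.

Lemma generic_closes c : choice_space c -> generic c ->
  construction_defined c /\ (P34 c <= m34 c)%VS.
Proof.
move=> cc gc.
have [[a1 A1E] [a2 A2E]] := (point_coordinates (A1 c), point_coordinates (A2 c)).
have [[a3 A3E] [a4 A4E]] := (point_coordinates (A3 c), point_coordinates (A4 c)).
have [p14 P14E] := point_coordinates (P14 c).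
have [p24 P24E] := point_coordinates (P24 c).
have [p34 P34E] := point_coordinates (P34 c).
have [[b1 B1E] [b2 B2E]] := (point_coordinates (B1 c), point_coordinates (B2 c)).
have /genericP/iffLR/(_ gc) : coordinates c a1 a2 a3 a4 p14 p24 p34 b1 b2.
  by split.
rewrite /genericity !mulf_eq0 !negb_or -!andbA.
case/and5P=> d14 d14' d24 d24'; case/and3P=> d34 d34' _.
have [_ /and3P[on14 on24 on34] _ onm12] := cc.
rewrite P14E /l14 A1E A4E -memvE in on14.
rewrite P24E /l24 A2E A4E -memvE in on24.
rewrite P34E /l34 A3E A4E -memvE in on34.
have [e1 a1E p14E] := side_lift on14 d14 d14'.
have [e2 a2E p24E] := side_lift on24 d24 d24'.
have [e3 a3E p34E] := side_lift on34 d34 d34'.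
rewrite {}a1E in A1E; rewrite {}a2E in A2E; rewrite {}a3E in A3E.
rewrite {}p14E in P14E; rewrite {}p24E in P24E; rewrite {}p34E in P34E.
have /genericP/iffLR/(_ gc) :
  coordinates c e1 e2 e3 a4 (e1 - a4) (e2 - a4) (e3 - a4) b1 b2.
  by split.
rewrite /genericity !mulf_eq0 !negb_or -!andbA.
case/and5P=> d14n _ _ _; case/and5P=> _ _ _ _; case/andP=> b2n _.
have d124 : bracket e1 e2 a4 != 0.
  suff -> : bracket e1 e2 a4 = - bracket e1 e2 (e1 - a4) by rewrite oppr_eq0.
  by rewrite /bracket !mxE; ring.
have [_ _ P12E] := meet_side d124.
move: onm12; rewrite /m12 /P12 /l12 A1E A2E P14E P24E P12E B1E B2E -memvE.
case/memv_addP=> _ /vlineP[s ->] [_ /vlineP[r ->] b2E].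
(* [s = 0] would mean [B2 = P12], which lies on [(P14 P24)]. *)
have s0 : s != 0.
  apply: contraNneq b2n => s0; apply/eqP.
  by rewrite b2E s0 /bracket !mxE; ring.
pose t := - (r / s).
have B2t : B2 c = <[b1 - t *: (e1 - e2)]>%VS :> {vspace _}.
  rewrite B2E b2E -(vline_scale (b1 - _) s0); congr <[_]>%VS.
  by apply/rowP => j; rewrite /t !mxE; field.
have ct : coordinates c e1 e2 e3 a4 (e1 - a4) (e2 - a4) (e3 - a4) b1
  (b1 - t *: (e1 - e2)).
  by split.
have /genericP/iffLR/(_ gc) gt := ct.
have [cA cP cB1 cB2] := ct.
by have [_ cd P34m] := normalised_configuration cA cP cB1 cB2 gt.
Qed.

(** The frame [e0, e1, e2, -(e0 + e1 + e2)] with [Pij] the class of [ai - aj], and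
[t = 1], [b1 = a1], which makes [bi = ai] for all [i]. *)
Lemma exists_generic_choice : exists c, choice_space c /\ generic c.
Proof.
pose e (i : 'I_3) : 'rV[K]_3 := delta_mx 0 i.
pose a4 : 'rV[K]_3 := const_mx (-1).
pose b2 := e 0 - 1 *: (e 0 - e 1).
have gen : genericity (e 0) (e 1) (e 2%:R) a4 (e 0 - a4) (e 1 - a4) (e 2%:R - a4)
    (e 0) b2 != 0.
  suff -> : genericity (e 0) (e 1) (e 2%:R) a4 (e 0 - a4) (e 1 - a4) (e 2%:R - a4)
    (e 0) b2 = 1 by rewrite oner_eq0.
  rewrite /genericity /crossing /bracket /b2 /e /a4 !mxE /=; ring.
have pt (u : 'rV[K]_3) j : u 0 j != 0 ->
    exists X : point K, X = <[u]>%VS :> {vspace _}.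
  move=> uj; have u0 : u != 0 by apply: contraNneq uj => ->; rewrite mxE.
  by exists (Point (is_point_vline u0)).
have ej i : e i 0 i != 0 by rewrite mxE !eqxx oner_eq0.
have pj i j : j != i -> (e i - a4) 0 j != 0.
  by move=> ji; rewrite !mxE (negPf ji) sub0r opprK oner_eq0.
have a4j : a4 0 0 != 0 by rewrite mxE oppr_eq0 oner_eq0.
have b2j : b2 0 1 != 0 by rewrite /b2 !mxE /= !sub0r mulrN opprK mul1r oner_eq0.
have [[X1 E1] [X2 E2]] := (pt _ _ (ej 0), pt _ _ (ej 1)).
have [[X3 E3] [X4 E4]] := (pt _ _ (ej 2%:R), pt _ _ a4j).
have [[X14 E14] [X24 E24]] := (pt _ _ (pj 0 1 isT), pt _ _ (pj 1 0 isT)).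
have [[X34 E34] [Y2 F2]] := (pt _ _ (pj 2%:R 0 isT), pt _ _ b2j).
pose c := Choices X1 X2 X3 X4 X14 X24 X34 X1 Y2.
have cc : coordinates c (e 0) (e 1) (e 2%:R) a4 (e 0 - a4) (e 1 - a4) (e 2%:R - a4)
  (e 0) b2 by split.
exists c; split; last by apply/(genericP cc).
have [cA cP cB1 cB2] := cc.
by have [] := normalised_configuration cA cP cB1 cB2 gen.
Qed.

End Genericity.

Lemma generic_choices_close (K : fieldType) :
  for_generic_choices (fun c : choices K =>
    construction_defined c /\ (P34 c <= m34 c)%VS).
Proof.
exists (fun p => ~ vanishes_at (genericity_poly K) p); split.
- by have [d fd] := multidegree_genericity_poly K; apply: zariski_open_nonvanishing fd.
- exact: exists_generic_choice.
- exact: generic_closes.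
Qed.

Theorem theorem3p4 (R : realType) :
  for_generic_choices (fun c : choices R =>
    construction_defined c /\ (P34 c <= m34 c)%VS) /\
  for_generic_choices (fun c : choices R[i]%C =>
    construction_defined c /\ (P34 c <= m34 c)%VS).
Proof. by split; apply: generic_choices_close. Qed.
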